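(* Let $\Lambda$ be a finite dimensional algebra over a field, $k\ge1$ an integer and $M$ a finitely generated right $\Lambda$-module. If $k\text{-}\operatorname{ddell}M<\infty$, then $(k+1)\text{-}\operatorname{ddell}(\Omega M)<\infty$, and therefore $k\text{-}\operatorname{ddell}(\Omega M)<\infty$.
   Context: $\mathrm{mod}\,\Lambda$ is the category of finitely generated right $\Lambda$-modules. $\mathbb N$ is the set of nonnegative integers; the infimum of the empty set is $+\infty$. $\Omega M$ is the kernel of a projective cover of $M$, $\Omega^0M=M$, $\Omega^{n+1}M=\Omega(\Omega^nM)$. ''$U$ is a direct summand of $V$ up to projective summands'' means that $U$ is isomorphic to a direct summand of $V\oplus P$ for some projective $P$. For an integer $j\ge1$, $j\text{-}\operatorname{dell}M$ is the infimum of all $n\in\mathbb N$ such that $\Omega^nM$ is a direct summand of $\Omega^{n+j}N$ up to projective summands for some $N\in\mathrm{mod}\,\Lambda$. $k\text{-}\operatorname{ddell}M$ is the infimum of all $m\in\mathbb N$ for which there exist $0\le n\le m$ and an exact sequence $0\to C_n\to\cdots\to C_1\to C_0\to M\to0$ in $\mathrm{mod}\,\Lambda$ with $(i+k)\text{-}\operatorname{dell}C_i\le m-i$ for $i=0,\dots,n$. *)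

(* Defs.v *)
From HB Require Import structures.
From mathcomp Require Import all_boot all_order all_algebra all_field.
From mathcomp Require Import boolp.

Set Implicit Arguments.
Unset Strict Implicit.
Unset Printing Implicit Defensive.

Import GRing.Theory.
Local Open Scope ring_scope.

(* Extended natural numbers: [None] is +oo. *)
Definition enat := option nat.

Definition enat_le_nat (x : enat) (m : nat) : bool :=
  if x is Some n then (n <= m)%N else false.

Definition enat_lt_infty (x : enat) : bool := x != None.

Lemma ex_asbool (P : nat -> Prop) : (exists n, P n) -> exists n, `[< P n >].
Proof. by case=> n Pn; exists n; apply/asboolP. Qed.

Definition enat_inf (P : nat -> Prop) : enat :=
  if pselect (exists n, P n) is left exP then Some (ex_minn (ex_asbool exP))
  else None.

Definition finitely_generated (R : pzRingType) (M : lmodType R) : Prop :=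
  exists (n : nat) (g : 'I_n -> M),
    forall x, exists c : 'I_n -> R, x = \sum_i c i *: g i.

Record fgmod (R : pzRingType) := FGMod {
  fgmod_lmod :> lmodType R;
  fgmodP : finitely_generated fgmod_lmod
}.

(* A right module over A is a left module over the converse ring A^c. *)
Definition rmod (K : fieldType) (A : falgType K) := fgmod A^c.

Definition surj (T U : Type) (f : T -> U) : Prop := forall y, exists x, f x = y.

Definition exact_at (R : pzRingType) (X Y Z : lmodType R)
    (f : {linear X -> Y}) (g : {linear Y -> Z}) : Prop :=
  forall y, g y = 0 <-> exists x, f x = y.

Definition isomorphic (R : pzRingType) (U V : lmodType R) : Prop :=
  exists f : {linear U -> V}, bijective f.

Definition direct_summand (R : pzRingType) (U V : lmodType R) : Prop :=
  exists W : lmodType R, isomorphic (U * W)%type V.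

Definition projective (R : pzRingType) (P : lmodType R) : Prop :=
  forall (X Y : lmodType R) (g : {linear X -> Y}) (f : {linear P -> Y}),
    surj g -> exists h : {linear P -> X}, forall x, g (h x) = f x.

(* Submodules S of P are given by (classically decidable) predicates. *)
Definition superfluous_kernel (R : pzRingType) (P M : lmodType R)
    (f : {linear P -> M}) : Prop :=
  forall S : {pred P}, submod_closed S ->
    (forall x, exists s t, [/\ s \in S, f t = 0 & x = s + t]) ->
    forall x, x \in S.

Definition projective_cover (R : pzRingType) (P M : lmodType R)
    (f : {linear P -> M}) : Prop :=
  [/\ projective P, surj f & superfluous_kernel f].

(* Omega M is only determined up to isomorphism, so it is given by the relation
   "X is isomorphic to the kernel of some projective cover of M". *)
Definition is_syzygy (R : pzRingType) (M X : fgmod R) : Prop :=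
  exists (P : fgmod R) (f : {linear P -> M}) (i : {linear X -> P}),
    [/\ projective_cover f, injective i & exact_at i f].

Fixpoint is_nth_syzygy (R : pzRingType) (n : nat) (M X : fgmod R) : Prop :=
  if n is n'.+1 then exists2 Y : fgmod R, is_nth_syzygy n' M Y & is_syzygy Y X
  else isomorphic M X.

Definition summand_upto_projective (R : pzRingType) (U V : fgmod R) : Prop :=
  exists2 P : fgmod R, projective P & direct_summand U (V * P)%type.

Definition dell (R : pzRingType) (j : nat) (M : fgmod R) : enat :=
  enat_inf (fun n => exists N X Y : fgmod R,
    [/\ is_nth_syzygy n M X, is_nth_syzygy (n + j)%N N Y
      & summand_upto_projective X Y]).

(* An exact sequence 0 -> C_n -> ... -> C_1 -> C_0 -> M -> 0, continued by
   C_i = 0 for i > n. *)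
Definition exact_resolution (R : pzRingType) (n : nat) (M : fgmod R)
    (C : nat -> fgmod R) (e : {linear C 0%N -> M})
    (d : forall i, {linear C i.+1 -> C i}) : Prop :=
  [/\ forall i, (n < i)%N -> forall x : C i, x = 0,
      surj e, exact_at (d 0%N) e & forall i, exact_at (d i.+1) (d i)].

Definition ddell (R : pzRingType) (k : nat) (M : fgmod R) : enat :=
  enat_inf (fun m => exists2 n, (n <= m)%N &
    exists (C : nat -> fgmod R) (e : {linear C 0%N -> M})
           (d : forall i, {linear C i.+1 -> C i}),
      exact_resolution n e d /\
      forall i, (i <= n)%N -> enat_le_nat (dell (i + k)%N (C i)) (m - i)%N).

(* Main.v *)
(* Cover the cycle modules of an exact sequence 0 -> C_n -> ... -> C_0 -> M -> 0
   by projectives: as in the horseshoe lemma, this gives an exact sequence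
   0 -> L_n -> ... -> L_0 -> Omega M -> 0 in which L_i is the kernel of an
   epimorphism from a projective onto C_i, hence Omega C_i up to projective
   summands. If Omega^n C_i is a stable summand of Omega^(n + j) N, then
   Omega^n L_i is one of Omega^(n + j + 1) N, so (j + 1)-dell L_i is at most
   j-dell C_i. Finally j-dell is at most (j + 1)-dell, since
   Omega^(n + j + 1) N = Omega^(n + j) (Omega N). *)

Require Import Defs.
From HB Require Import structures.
From mathcomp Require Import all_boot all_order all_algebra all_field.
From mathcomp Require Import boolp.
Set Implicit Arguments.
Unset Strict Implicit.
Unset Printing Implicit Defensive.
Import GRing.Theory.
Local Open Scope ring_scope.

(** * Submodules given by predicates, and factoring linear maps *)

Definition mk_linear (R : pzRingType) (U V : lmodType R) (f : U -> V)
    (f_lin : linear f) : {linear U -> V} :=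
  HB.pack f (GRing.isLinear.Build R U V *:%R f f_lin).

Definition submodule (R : pzRingType) (V : lmodType R) (S : V -> Prop) : Prop :=
  S 0 /\ forall a x y, S x -> S y -> S (a *: x + y).

Lemma submodule_object (R : pzRingType) (V : lmodType R) (S : V -> Prop) :
  submodule S -> exists (W : lmodType R) (w : {linear W -> V}),
    injective w /\ forall x, S x <-> exists z, w z = x.
Proof.
move=> [S0 SD].
pose Sb : pred V := fun x => `[< S x >].
have Sb_closed : submod_closed Sb.
  split=> [|a x y]; rewrite !unfold_in; first exact/asboolP.
  by move=> /asboolP Sx /asboolP Sy; apply/asboolP/SD.
pose W : subLmodType Sb := HB.pack {x : V | Sb x}
  (GRing.SubChoice_isSubLmodule.Build R V Sb {x : V | Sb x} Sb_closed).
exists W, (val : {linear W -> V}); split; first exact: val_inj.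
move=> x; split=> [/asboolP Sx|[z <-]]; last exact/asboolP/(valP z).
by exists (Sub x Sx : W); exact: SubK.
Qed.

Lemma linear_factor (R : pzRingType) (X Y Z : lmodType R)
    (f : {linear X -> Y}) (i : {linear Z -> Y}) :
  injective i -> (forall x, exists z, i z = f x) ->
  exists h : {linear X -> Z}, forall x, i (h x) = f x.
Proof.
move=> i_inj /choice[h hE].
have h_lin : linear h.
  by move=> a x y; apply: i_inj; rewrite linearP !hE linearP.
by exists (mk_linear h_lin).
Qed.

Lemma submodule_image (R : pzRingType) (U V : lmodType R) (f : {linear U -> V})
    (S : U -> Prop) :
  submodule S -> submodule (fun y => exists2 x, S x & f x = y).
Proof.
move=> [S0 SD]; split=> [|a _ _ [x Sx <-] [y Sy <-]].
  by exists 0; rewrite ?linear0.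
by exists (a *: x + y); [exact: SD | rewrite linearP].
Qed.

Lemma submodule_kernel (R : pzRingType) (U V : lmodType R)
    (f : {linear U -> V}) : submodule (fun x => f x = 0).
Proof.
by split=> [|a x y fx fy]; rewrite ?linear0 // linearP fx fy scaler0 addr0.
Qed.

Lemma submodule_range (R : pzRingType) (U V : lmodType R)
    (f : {linear U -> V}) : submodule (fun y => exists x, f x = y).
Proof.
split=> [|a _ _ [x <-] [y <-]]; first by exists 0; rewrite linear0.
by exists (a *: x + y); rewrite linearP.
Qed.

(** Corestricting both maps to the range of [g] makes [g] surjective, so the defining property of
    [P] applies. *)
Lemma projective_lift (R : pzRingType) (P X Y : lmodType R)
    (g : {linear X -> Y}) (f : {linear P -> Y}) :
  projective P -> (forall x, exists y, g y = f x) ->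
  exists h : {linear P -> X}, forall x, g (h x) = f x.
Proof.
move=> P_proj fg.
have [W [w [w_inj wE]]] := submodule_object (submodule_range g).
have [g' g'E] : exists g' : {linear X -> W}, forall x, w (g' x) = g x.
  by apply: linear_factor => // x; apply/wE; exists x.
have [f' f'E] : exists f' : {linear P -> W}, forall x, w (f' x) = f x.
  by apply: linear_factor => // x; apply/wE.
have g'_surj : surj g'.
  move=> z; have [x xE] : exists x, g x = w z by apply/wE; exists z.
  by exists x; apply: w_inj; rewrite g'E.
have [h hE] := P_proj _ _ g' f' g'_surj.
by exists h => x; rewrite -g'E hE f'E.
Qed.

(** * Retracts, direct summands and projectives *)

Definition retract (R : pzRingType) (U V : lmodType R) : Prop :=
  exists (i : {linear U -> V}) (r : {linear V -> U}), forall x, r (i x) = x.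

Lemma retract_trans (R : pzRingType) (U V W : lmodType R) :
  retract U V -> retract V W -> retract U W.
Proof.
move=> [i [r ri]] [j [s sj]].
by exists (j \o i), (r \o s) => x; rewrite /= sj ri.
Qed.

Lemma isomorphic_retract (R : pzRingType) (U V : lmodType R) :
  isomorphic U V -> retract U V /\ retract V U.
Proof.
move=> [f [g fK gK]].
have g_lin : linear g.
  by move=> a x y; apply: (can_inj fK); rewrite linearP !gK.
by split; [exists f, (mk_linear g_lin) | exists (mk_linear g_lin), f].
Qed.

Lemma isomorphic_refl (R : pzRingType) (U : lmodType R) : isomorphic U U.
Proof. by exists (idfun : {linear U -> U}); exists id. Qed.

(** The complement is the kernel of the retraction [r], with projection [y - i (r y)]. Retracts
    compose without carrying complements along. *)
Lemma direct_summandP (R : pzRingType) (U V : lmodType R) :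
  direct_summand U V <-> retract U V.
Proof.
split=> [[W /isomorphic_retract[UWV _]]|[i [r ri]]].
  apply: retract_trans UWV.
  have inl_lin : linear (fun x : U => (x, 0) : (U * W)%type).
    by move=> a x y; congr pair => //=; rewrite scaler0 addr0.
  have fst_lin : linear (fun z : (U * W)%type => z.1) by [].
  by exists (mk_linear inl_lin), (mk_linear fst_lin).
have [W [w [w_inj wE]]] := submodule_object (submodule_kernel r).
have [p pE] : exists p : {linear V -> W}, forall y, w (p y) = y - i (r y).
  have f_lin : linear (fun y => y - i (r y)).
    by move=> a x y; rewrite !linearP addrACA -scalerDr.
  apply: (linear_factor (f := mk_linear f_lin)) => // y.
  by apply/wE; rewrite /= linearB ri subrr.
have s_lin : linear (fun z : (U * W)%type => i z.1 + w z.2).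
  by move=> a x y; rewrite /= !linearP addrACA scalerDr.
have rw z : r (w z) = 0 by apply/wE; exists z.
exists W, (mk_linear s_lin), (fun y => (r y, p y)) => [[x z]|y] /=.
  have rE : r (i x + w z) = x by rewrite linearD ri rw addr0.
  by congr pair => //; apply: w_inj; rewrite pE rE addrC addKr.
by rewrite pE addrC subrK.
Qed.

Lemma retract_projective (R : pzRingType) (U P : lmodType R) :
  retract U P -> projective P -> projective U.
Proof.
move=> [i [r ri]] P_proj X Y g f g_surj.
have [h hE] := P_proj _ _ g (f \o r) g_surj.
by exists (h \o i) => x; rewrite /= hE /= ri.
Qed.

Lemma projective_prod (R : pzRingType) (P Q : lmodType R) :
  projective P -> projective Q -> projective (P * Q)%type.
Proof.
move=> P_proj Q_proj X Y g f g_surj.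
have inl_lin : linear (fun x : P => (x, 0) : (P * Q)%type).
  by move=> a x y; congr pair => //=; rewrite scaler0 addr0.
have inr_lin : linear (fun x : Q => (0, x) : (P * Q)%type).
  by move=> a x y; congr pair => //=; rewrite scaler0 addr0.
have [h hE] := P_proj _ _ g (f \o mk_linear inl_lin) g_surj.
have [k kE] := Q_proj _ _ g (f \o mk_linear inr_lin) g_surj.
have s_lin : linear (fun z : (P * Q)%type => h z.1 + k z.2).
  by move=> a x y; rewrite /= !linearP addrACA scalerDr.
exists (mk_linear s_lin) => -[x y] /=; rewrite linearD hE kE /= -linearD.
by congr (f _); congr pair; rewrite /= ?addr0 ?add0r.
Qed.

(** * Finitely generated modules and free covers *)

Lemma finitely_generated_surj (R : pzRingType) (U V : lmodType R)
    (f : {linear U -> V}) :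
  surj f -> finitely_generated U -> finitely_generated V.
Proof.
move=> f_surj [n [g gE]]; exists n, (f \o g) => y.
have [x <-] := f_surj y; have [c ->] := gE x; exists c.
by rewrite linear_sum; apply: eq_bigr => i _; rewrite linearZ.
Qed.

Lemma finitely_generated_prod (R : pzRingType) (U V : lmodType R) :
  finitely_generated U -> finitely_generated V ->
  finitely_generated (U * V)%type.
Proof.
move=> [m [g gE]] [n [h hE]].
exists (m + n)%N, (fun i => match split i with
  | inl i => (g i, 0) | inr i => (0, h i) end) => -[x y].
have [c ->] := gE x; have [d ->] := hE y.
exists (fun i => match split i with inl i => c i | inr i => d i end).
rewrite big_split_ord /=.
have splitl (i : 'I_m) : split (lshift n i) = inl i.
  exact: (unsplitK (inl i)).
have splitr (i : 'I_n) : split (rshift m i) = inr i.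
  exact: (unsplitK (inr i)).
under [X in _ = X + _]eq_bigr do rewrite splitl.
under [X in _ = _ + X]eq_bigr do rewrite splitr.
have fst_lin : linear (fun z : (U * V)%type => z.1) by [].
have snd_lin : linear (fun z : (U * V)%type => z.2) by [].
apply/eqP; rewrite -pair_eqE /=; apply/andP; split; apply/eqP.
  rewrite (linear_sum (mk_linear fst_lin)) (linear_sum (mk_linear fst_lin)) /=.
  by rewrite [X in _ + X]big1 ?addr0 // => i _; rewrite scaler0.
rewrite (linear_sum (mk_linear snd_lin)) (linear_sum (mk_linear snd_lin)) /=.
by rewrite [X in X + _]big1 ?add0r // => i _; rewrite scaler0.
Qed.

Definition fgmod_prod (R : pzRingType) (U V : fgmod R) : fgmod R :=
  FGMod (finitely_generated_prod (fgmodP U) (fgmodP V)).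

Lemma finitely_generated_free (R : pzRingType) (n : nat) :
  finitely_generated 'rV[R]_n.
Proof.
exists n, (fun i => delta_mx 0 i) => x; exists (fun i => x 0 i).
exact: row_sum_delta.
Qed.

Lemma free_lift (R : pzRingType) (n : nat) (V : lmodType R) (g : 'I_n -> V) :
  exists f : {linear 'rV[R]_n -> V}, forall x, f x = \sum_i x 0 i *: g i.
Proof.
have f_lin : linear (fun x : 'rV[R]_n => \sum_i x 0 i *: g i).
  move=> a x y; rewrite scaler_sumr -big_split /=; apply: eq_bigr => i _.
  by rewrite !mxE scalerDl scalerA.
by exists (mk_linear f_lin).
Qed.

Lemma projective_free (R : pzRingType) (n : nat) : projective 'rV[R]_n.
Proof.
move=> X Y g f g_surj.
have [u uE] := choice (fun i : 'I_n => g_surj (f (delta_mx 0 i))).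
have [h hE] := free_lift u; exists h => x.
rewrite hE linear_sum {2}(row_sum_delta x) linear_sum.
by apply: eq_bigr => i _; rewrite !linearZ /= uE.
Qed.

Lemma free_cover (R : pzRingType) (M : fgmod R) :
  exists (P : fgmod R) (f : {linear P -> M}), projective P /\ surj f.
Proof.
have [n [g gE]] := fgmodP M; have [f fE] := free_lift g.
exists (FGMod (@finitely_generated_free R n)), f.
split=> [|y]; first exact: projective_free.
have [c ->] := gE y; exists (\row_i c i); rewrite fE.
by apply: eq_bigr => i _; rewrite mxE.
Qed.

(** * Bounded chains and generators of submodules *)

(* [V] has length at most [d]. *)
Definition chain_bound (R : pzRingType) (V : lmodType R) (d : nat) : Prop :=
  forall S : nat -> V -> Prop,
    (forall i, submodule (S i)) -> (forall i x, S i x -> S i.+1 x) ->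
    exists2 i, (i <= d)%N & forall x, S i.+1 x -> S i x.

(** The one finiteness condition on the ring in the argument: it makes submodules finitely generated
    and supplies Fitting's lemma. *)
Definition bounded_chains (R : pzRingType) : Prop :=
  forall M : fgmod R, exists d, chain_bound M d.

(** Push a chain of [W] into [V] and continue it by all of [V] from index [d.+1] on. It must stall
    by step [d], but not at step [d] itself, since [v] is not in the image of [w]. *)
Lemma chain_bound_proper (R : pzRingType) (V W : lmodType R) (d : nat)
    (w : {linear W -> V}) (v : V) :
  chain_bound V d -> injective w -> (forall z, w z <> v) ->
  exists2 d', d = d'.+1 & chain_bound W d'.
Proof.
move=> dV w_inj wv.
pose T (S : nat -> W -> Prop) i x := (d < i)%N \/ exists2 z, S i z & w z = x.
have chain (S : nat -> W -> Prop) :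
    (forall i, submodule (S i)) -> (forall i x, S i x -> S i.+1 x) ->
    exists2 i, (i < d)%N & forall x, S i.+1 x -> S i x.
  move=> S_sub S_mono; have [||i] := dV (T S).
  - move=> i; rewrite /T; case: (ltnP d i) => di; first by split; left.
    have [T0 TD] := submodule_image w (S_sub i).
    by split=> [|a x y [//|Tx] [//|Ty]]; right=> //; exact: TD.
  - move=> i x [di|[z Sz <-]]; first by left; exact: ltnW.
    by right; exists z => //; exact: S_mono.
  rewrite leq_eqVlt => /orP[/eqP -> /(_ v) [||[z _ /wv//]]|id TS].
  - by left.
  - by rewrite ltnn.
  exists i => // x Sx; have [||[z Sz /w_inj<-//]] := TS (w x).
    by right; exists x.
  by rewrite ltnNge ltnW.
(* For [d = 0] a constant chain would stall at an index below 0. *)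
case: d dV @T chain => [|d] _ _ chain.
  by have [] := chain (fun _ _ => True).
by exists d => // S S_sub S_mono; exact: chain.
Qed.

Definition spanned (R : pzRingType) (V : lmodType R) (s : seq V) (x : V) :=
  forall T, submodule T -> (forall y, y \in s -> T y) -> T x.

Lemma submodule_spanned (R : pzRingType) (V : lmodType R) (s : seq V) :
  submodule (spanned s).
Proof.
split=> [T [T0 _] _|a x y sx sy T T_sub sT]; first exact: T0.
by apply: T_sub.2; [exact: sx | exact: sy].
Qed.

Lemma submodule_sum (R : pzRingType) (V : lmodType R) (n : nat)
    (g : 'I_n -> V) :
  submodule (fun x => exists c : 'I_n -> R, x = \sum_i c i *: g i).
Proof.
split=> [|a _ _ [c ->] [d ->]].
  by exists (fun => 0); rewrite big1 // => i _; rewrite scale0r.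
exists (fun i => a * c i + d i).
rewrite scaler_sumr -big_split /=; apply: eq_bigr => i _.
by rewrite scalerDl scalerA.
Qed.

(** Otherwise one could keep adjoining an element of [S] outside the current span, and the spans
    would ascend strictly forever. *)
Lemma submodule_generators (R : pzRingType) (V : lmodType R) (d : nat)
    (S : V -> Prop) :
  chain_bound V d -> submodule S ->
  exists2 s : seq V, (forall x, x \in s -> S x) & forall x, S x -> spanned s x.
Proof.
move=> dV S_sub; apply: contrapT => noS.
(* The guard on [s] makes the claim hold for every list, so that choice gives a total function
   [u]. *)
have next s : exists x, (forall y, y \in s -> S y) -> S x /\ ~ spanned s x.
  apply: contrapT => /forallNP no_next; apply: noS.
  exists s => [x|x Sx]; last first.
    by apply: contrapT => sx; apply: (no_next x).
  by apply: contrapT => sS; apply: (no_next 0) => /(_ x)/sS.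
have {next} [u uE] := choice next.
pose t i := iter i (fun s => u s :: s) [::].
have tS i : forall y, y \in t i -> S y.
  elim: i => [//|i IH] y; rewrite inE => /predU1P[->|/IH//].
  by have [] := uE _ IH.
have [||i _ /(_ (u (t i)))] := dV (fun i => spanned (t i)).
- by move=> i; exact: submodule_spanned.
- move=> i x tx T T_sub tT; apply: tx => // y ty; apply: tT.
  by rewrite inE ty orbT.
have [_ nu] := uE _ (tS i); move=> H; apply: nu; apply: H => T _; apply.
exact: mem_head.
Qed.

Lemma submodule_fgmod (R : pzRingType) (M : fgmod R) (S : M -> Prop) :
  bounded_chains R -> submodule S ->
  exists (W : fgmod R) (w : {linear W -> M}),
    injective w /\ forall x, S x <-> exists z, w z = x.
Proof.
move=> /(_ M)[d dM] S_sub; have [s sS Ss] := submodule_generators dM S_sub.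
have [W [w [w_inj wE]]] := submodule_object S_sub.
have gens i : exists z, w z = s`_(i : 'I_(size s)).
  by apply/wE/sS/mem_nth.
have {gens} [g gE] := choice gens.
have W_fg : finitely_generated W.
  exists (size s), g => z.
  have /Ss /(_ _ (submodule_sum (fun i : 'I_(size s) => s`_i))) [|c wz] :
    S (w z) by apply/wE; exists z.
    move=> y /(nthP 0)[i i_lt <-]; exists (fun j => (j == i :> nat)%:R).
    rewrite (bigD1 (Ordinal i_lt)) //= eqxx scale1r big1 ?addr0 // => j.
    by rewrite -val_eqE /= => /negPf->; rewrite scale0r.
  exists c; apply: w_inj; rewrite wz linear_sum.
  by apply: eq_bigr => i _; rewrite linearZ /= gE.
by exists (FGMod W_fg), w.
Qed.

(** * Existence of projective covers and syzygies *)

(* Fitting's lemma: [V] is the direct sum of the kernel and the image of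
   [h ^ N.+1]. *)
Lemma fitting_power (R : pzRingType) (V : lmodType R) (d : nat)
    (h : {linear V -> V}) :
  chain_bound V d -> exists N,
    (forall x, iter N.+1 h (iter N.+1 h x) = 0 -> iter N.+1 h x = 0) /\
    (forall x, exists y, iter N.+1 h x = iter N.+1 h (iter N.+1 h y)).
Proof.
move=> dV.
have iter_lin i : linear (iter i h).
  by elim: i => [//|i IH] a x y; rewrite /= IH linearP.
have iter0 i : iter i h 0 = 0 by elim: i => [//|i IH]; rewrite iterS IH linear0.
have [||a _ kerS] := dV (fun i x => iter i h x = 0).
- by move=> i; exact: (submodule_kernel (mk_linear (iter_lin i))).
- by move=> i x; rewrite iterS => ->; rewrite linear0.
(* The images of the powers descend; the exponent [d.+1 - i] reverses them into an ascending chain,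
   constant once truncated subtraction gives 0. *)
have [||b b_le imS] := dV (fun i x => exists y, iter (d.+1 - i) h y = x).
- by move=> i; exact: (submodule_range (mk_linear (iter_lin (d.+1 - i)%N))).
- move=> i x [y <-]; case: (leqP i d) => i_le.
    by exists (h y); rewrite -iterSr -subSn // subSS.
  have /eqP d0 : (d.+1 - i == 0)%N by rewrite subn_eq0.
  have /eqP d1 : (d.+1 - i.+1 == 0)%N by rewrite subn_eq0 ltnW.
  by exists y; rewrite d0 d1.
have {}kerS m x : iter (m + a) h x = 0 -> iter a h x = 0.
  elim: m => [//|m IH]; rewrite (_ : m.+1 + a = a.+1 + m)%N; last first.
    by rewrite addSnnS addnC.
  by rewrite iterD => /kerS; rewrite -iterD addnC.
have {}imS m x : exists y, iter (d - b) h x = iter (m + (d - b)) h y.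
  elim: m => [|m [y ->]]; first by exists x.
  have [|z zE] := imS (iter (d - b) h y); first by exists y; rewrite subSS.
  by exists z; rewrite iterD -zE -iterD subSn // addSnnS.
(* [N] is at least both [a], where the kernels stabilise, and [d - b], where the images do. *)
set N := (a + (d - b))%N; exists N; split=> x.
  have NE : N.+1 = ((d - b).+1 + a)%N by rewrite addSn addnC.
  rewrite -iterD [in iter (_ + _)]NE addnA => /kerS xa0.
  by rewrite NE iterD xa0 iter0.
have [y yE] := imS N.+1 x; exists y.
have -> : iter N.+1 h x = iter a.+1 h (iter (d - b) h x) by rewrite -iterD.
by rewrite yE -!iterD addnCA.
Qed.

Lemma projective_cover_exists (R : pzRingType) (M : fgmod R) :
  bounded_chains R ->
  exists (P : fgmod R) (f : {linear P -> M}), projective_cover f.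
Proof.
move=> R_bd; have [P [f [P_proj f_surj]]] := free_cover M.
(* If [S + ker f = P] with [S] proper, lift [f] to [h : P -> S]; by Fitting, the
   image of a power of [h] is a summand of [P] inside [S] that still covers [M],
   and it is shorter than [P]. *)
have [d] := R_bd P.
elim/ltn_ind: d P f P_proj f_surj => d IH P f P_proj f_surj dP.
have [f_sup|] := pselect (superfluous_kernel f); first by exists P, f.
move=> /existsNP[S /not_implyP[[S0 SD] /not_implyP[S_ker /existsNP[v Sv]]]].
have [W [w [w_inj wE]]] :=
  @submodule_object R P (fun x => x \in S) (conj S0 SD).
have fw_surj : surj (f \o w).
  move=> y; have [x <-] := f_surj y.
  have [s [t [/wE[z <-] ft ->]]] := S_ker x.
  by exists z; rewrite linearD ft addr0.
have [h0 h0E] := P_proj _ _ (f \o w) f fw_surj.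
have [N [kerN imN]] := fitting_power (w \o h0) dP.
have u_lin : linear (iter N.+1 (w \o h0)).
  by elim: N.+1 => [//|i IHi] a x y; rewrite !iterS IHi linearP.
have [u uE] : exists u : {linear P -> P}, forall x, u x = iter N.+1 (w \o h0) x.
  by exists (mk_linear u_lin).
have {}kerN x : u (u x) = 0 -> u x = 0 by rewrite !uE; exact: kerN.
have {}imN x : exists y, u x = u (u y).
  by have [y yE] := imN x; exists y; rewrite !uE.
(* The exponent is positive, so the outermost factor of [u] is [w]. *)
have uS x : u x \in S by apply/wE; rewrite uE /=; eexists.
have fu x : f (u x) = f x.
  by rewrite uE; elim: N.+1 => [//|i IHi]; rewrite iterS -IHi -[RHS]h0E.
have [I [i [i_inj iE]]] := submodule_object (submodule_range u).
(* By [kerN] the kernel and the image of [u] meet only in 0. *)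
have ui_inj : injective (u \o i).
  move=> z t /= uzt; apply: i_inj; apply/eqP; rewrite -subr_eq0 -linearB.
  have [x xE] : exists x, u x = i (z - t) by apply/iE; exists (z - t).
  by rewrite -xE kerN // xE !linearB uzt subrr.
(* [p x] is the preimage of [u x] under the injective map [u \o i], which has the same range as [u];
   it splits [i]. *)
have [p pE] : exists p : {linear P -> I}, forall x, (u \o i) (p x) = u x.
  apply: linear_factor => // x; have [y ->] := imN x.
  have [z zE] : exists z, i z = u y by apply/iE; exists y.
  by exists z; rewrite /= zE.
have pK z : p (i z) = z by apply: ui_inj; rewrite pE.
have p_surj : surj p by move=> z; exists (i z).
pose I_fg := FGMod (finitely_generated_surj p_surj (fgmodP P)).
have [|d' d'E dI] := chain_bound_proper dP i_inj (v := v).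
  move=> z iz; apply: Sv; have [x <-] : exists x, u x = v by apply/iE; exists z.
  exact: uS.
apply: (IH d' _ I_fg (f \o i)) => //; first by rewrite d'E.
  by apply: retract_projective P_proj; exists i, p.
move=> y; have [x <-] := f_surj y.
have [z zE] : exists z, i z = u x by apply/iE; exists x.
by exists z; rewrite /= zE fu.
Qed.

Lemma syzygy_exists (R : pzRingType) (M : fgmod R) :
  bounded_chains R -> exists X : fgmod R, is_syzygy M X.
Proof.
move=> R_bd; have [P [f f_cover]] := projective_cover_exists M R_bd.
have [X [i [i_inj iE]]] := submodule_fgmod R_bd (submodule_kernel f).
by exists X, P, f, i.
Qed.

Lemma nth_syzygy_exists (R : pzRingType) (n : nat) (M : fgmod R) :
  bounded_chains R -> exists X : fgmod R, is_nth_syzygy n M X.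
Proof.
move=> R_bd; elim: n => [|n [Y nY]]; first by exists M; exact: isomorphic_refl.
by have [X YX] := syzygy_exists Y R_bd; exists X, Y.
Qed.

(** [is_nth_syzygy] peels off the last syzygy, so the first one, which serves as [N'], is reached by
    induction. *)
Lemma nth_syzygy_shift (R : pzRingType) (n : nat) (N Y : fgmod R) :
  is_nth_syzygy n.+1 N Y -> exists N', is_nth_syzygy n N' Y.
Proof.
elim: n Y => [|n IH] Y [Z NZ ZY]; first by exists Y; exact: isomorphic_refl.
by have [N' N'Z] := IH _ NZ; exists N', Z.
Qed.

(** * Stable summands and kernels of projective epimorphisms *)

Lemma summand_upto_projectiveP (R : pzRingType) (U V : fgmod R) :
  summand_upto_projective U V <->
  exists2 P : fgmod R, projective P & retract U (V * P)%type.
Proof. by split=> -[P P_proj /direct_summandP UV]; exists P. Qed.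

Lemma retract_prod (R : pzRingType) (U V P : lmodType R) :
  retract U V -> retract (U * P)%type (V * P)%type.
Proof.
move=> [i [r ri]].
have f_lin : linear (fun z : (U * P)%type => (i z.1, z.2) : (V * P)%type).
  by move=> a x y; congr pair; rewrite /= ?linearP.
have g_lin : linear (fun z : (V * P)%type => (r z.1, z.2) : (U * P)%type).
  by move=> a x y; congr pair; rewrite /= ?linearP.
by exists (mk_linear f_lin), (mk_linear g_lin) => -[x y] /=; rewrite ri.
Qed.

Lemma retract_prodA (R : pzRingType) (U V W : lmodType R) :
  retract ((U * V) * W)%type (U * (V * W))%type.
Proof.
have f_lin : linear (fun z : ((U * V) * W)%type =>
  (z.1.1, (z.1.2, z.2)) : (U * (V * W))%type) by [].
have g_lin : linear (fun z : (U * (V * W))%type =>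
  ((z.1, z.2.1), z.2.2) : ((U * V) * W)%type) by [].
by exists (mk_linear f_lin), (mk_linear g_lin) => -[[x y] z].
Qed.

Lemma summand_upto_projective_trans (R : pzRingType) (U V W : fgmod R) :
  summand_upto_projective U V -> summand_upto_projective V W ->
  summand_upto_projective U W.
Proof.
move=> /summand_upto_projectiveP[P P_proj UV].
move=> /summand_upto_projectiveP[Q Q_proj VW]; apply/summand_upto_projectiveP.
exists (fgmod_prod Q P); first exact: projective_prod.
apply: retract_trans UV _; apply: retract_trans (retract_prod P VW) _.
exact: retract_prodA.
Qed.

(* With lifts [alpha : P -> Q * T] and [beta : Q * T -> P] of the inclusion and
   the projection, [a |-> (alpha a, a)] is split by
   [(b, p) |-> beta b + (p - beta (alpha p))]. *)
Lemma kernel_retract (R : pzRingType) (U V X Y P Q T : lmodType R)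
    (f : {linear P -> U}) (g : {linear Q -> V})
    (i : {linear X -> P}) (j : {linear Y -> Q}) :
  projective P -> projective Q -> projective T -> surj f -> surj g ->
  injective i -> exact_at i f -> injective j -> exact_at j g ->
  retract U (V * T)%type -> retract X (Y * P)%type.
Proof.
move=> P_proj Q_proj T_proj f_surj g_surj i_inj iE j_inj jE [s [r rs]].
have gT_lin : linear (fun z : (Q * T)%type => (g z.1, z.2) : (V * T)%type).
  by move=> a x y; congr pair; rewrite /= ?linearP.
have gT_surj : surj (mk_linear gT_lin).
  by move=> [v t]; have [q <-] := g_surj v; exists (q, t).
have [al alE] := P_proj _ _ (mk_linear gT_lin) (s \o f) gT_surj.
have [be beE] :=
  projective_prod Q_proj T_proj (r \o mk_linear gT_lin) f_surj.
have gal x : g (al (i x)).1 = 0 /\ (al (i x)).2 = 0.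
  have := alE (i x); rewrite /= (_ : f (i x) = 0); last by apply/iE; exists x.
  by rewrite linear0 => -[].
have fst_lin : linear (fun z : (Q * T)%type => z.1) by [].
have [l lE] : exists l : {linear X -> Y}, forall x, j (l x) = (al (i x)).1.
  apply: (linear_factor (f := mk_linear fst_lin \o (al \o i))) => // x.
  by apply/jE; case: (gal x).
have inl_lin : linear (fun x : Q => (x, 0) : (Q * T)%type).
  by move=> a x y; congr pair => //=; rewrite scaler0 addr0.
pose bj : {linear Y -> P} := be \o (mk_linear inl_lin \o j).
pose ba : {linear P -> P} := be \o al.
have fbj y : f (bj y) = 0.
  rewrite beE /= (_ : g (j y) = 0) ?linear0 //.
  by apply/jE; exists y.
(* Since [r \o s] is the identity, [p - ba p] lies in the kernel of [f]. *)
have fba p : f (ba p) = f p.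
  exact: etrans (beE (al p)) (etrans (congr1 r (alE p)) (rs _)).
have m_lin : linear (fun z : (Y * P)%type => bj z.1 + (z.2 - ba z.2)).
  move=> a x y; rewrite (linearP bj a x.1 y.1) (linearP ba a x.2 y.2).
  by rewrite opprD -scalerN [X in _ + X = _]addrACA -scalerDr addrACA -scalerDr.
have [m mE] : exists m : {linear (Y * P)%type -> X},
    forall z, i (m z) = bj z.1 + (z.2 - ba z.2).
  apply: (linear_factor (f := mk_linear m_lin)) => // z.
  by apply/iE; rewrite linearD linearB fbj fba subrr addr0.
have n_lin : linear (fun x => (l x, i x) : (Y * P)%type).
  by move=> a x y; congr pair; rewrite /= ?linearP.
exists (mk_linear n_lin), m => x; apply: i_inj; rewrite mE /= lE.
(* The second component of [al (i x)] is 0, so [bj (l x) = ba (i x)] and the sum collapses to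
   [i x]. *)
have [_ al2] := gal x; rewrite -al2 -surjective_pairing.
by rewrite addrC subrK.
Qed.

(** A form of Schanuel's lemma. The epimorphisms need not be covers, since those onto the terms of a
    resolution will not be minimal. *)
Lemma summand_kernel (R : pzRingType) (U V X Y P Q : fgmod R)
    (f : {linear P -> U}) (g : {linear Q -> V})
    (i : {linear X -> P}) (j : {linear Y -> Q}) :
  projective P -> projective Q -> surj f -> surj g ->
  injective i -> exact_at i f -> injective j -> exact_at j g ->
  summand_upto_projective U V -> summand_upto_projective X Y.
Proof.
move=> P_proj Q_proj f_surj g_surj i_inj iE j_inj jE.
move=> /summand_upto_projectiveP[T T_proj UV]; apply/summand_upto_projectiveP.
exists P => //; exact: (kernel_retract P_proj Q_proj T_proj f_surj g_surj
  i_inj iE j_inj jE UV).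
Qed.

Lemma summand_syzygy (R : pzRingType) (U V X Y : fgmod R) :
  is_syzygy U X -> is_syzygy V Y ->
  summand_upto_projective U V -> summand_upto_projective X Y.
Proof.
move=> [P [f [i [[P_proj f_surj _] i_inj iE]]]].
move=> [Q [g [j [[Q_proj g_surj _] j_inj jE]]]].
exact: (summand_kernel P_proj Q_proj f_surj g_surj i_inj iE j_inj jE).
Qed.

Lemma retract_summand (R : pzRingType) (U V : fgmod R) :
  retract U V -> summand_upto_projective U V.
Proof.
move=> UV; apply/summand_upto_projectiveP.
exists (FGMod (@finitely_generated_free R 0)); first exact: projective_free.
apply: retract_trans UV _.
have inl_lin : linear (fun x : V => (x, 0) : (V * 'rV[R]_0)%type).
  by move=> a x y; congr pair => //=; rewrite scaler0 addr0.
have fst_lin : linear (fun z : (V * 'rV[R]_0)%type => z.1) by [].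
by exists (mk_linear inl_lin), (mk_linear fst_lin).
Qed.

(** [L] is stably a summand of the first syzygy of [C] by Schanuel; taking syzygies [n] times
    preserves this. *)
Lemma summand_syzygy_kernel (R : pzRingType) (n : nat)
    (C L Q X X1 L' : fgmod R) (f : {linear Q -> C}) (l : {linear L -> Q}) :
  projective Q -> surj f -> injective l -> exact_at l f ->
  is_nth_syzygy n C X -> is_syzygy X X1 -> is_nth_syzygy n L L' ->
  summand_upto_projective L' X1.
Proof.
move=> Q_proj f_surj l_inj lE; elim: n X X1 L' => [|n IH] X X1 L'.
  move=> /isomorphic_retract[CX _] XX1 /isomorphic_retract[_ L'L].
  apply: summand_upto_projective_trans (retract_summand L'L) _.
  have [P [g [i [[P_proj g_surj _] i_inj iE]]]] := XX1.
  apply: (summand_kernel Q_proj P_proj f_surj g_surj l_inj lE i_inj iE).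
  exact: retract_summand.
move=> [Z CZ ZX] XX1 [M' LM' M'L'].
exact: (summand_syzygy M'L' XX1 (IH _ _ _ CZ ZX LM')).
Qed.

(** * Infima and bounds on [dell] *)

Lemma enat_infP (P : nat -> Prop) :
  enat_lt_infty (enat_inf P) <-> exists n, P n.
Proof. by rewrite /enat_inf; case: pselect => exP; split. Qed.

Lemma enat_inf_leP (P : nat -> Prop) (m : nat) :
  enat_le_nat (enat_inf P) m <-> exists2 n, (n <= m)%N & P n.
Proof.
rewrite /enat_inf; case: pselect => exP /=; last first.
  by split=> // -[n _ Pn]; case: exP; exists n.
case: ex_minnP => n /asboolP Pn n_min; split=> [nm|[p pm Pp]].
  by exists n.
by apply: leq_trans pm; apply/n_min/asboolP.
Qed.

Lemma dell_kernel (R : pzRingType) (j m : nat) (C L Q : fgmod R)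
    (f : {linear Q -> C}) (l : {linear L -> Q}) :
  bounded_chains R ->
  projective Q -> surj f -> injective l -> exact_at l f ->
  enat_le_nat (dell j C) m -> enat_le_nat (dell j.+1 L) m.
Proof.
move=> R_bd Q_proj f_surj l_inj lE /enat_inf_leP[n nm [N [X [Y [CX NY XY]]]]].
apply/enat_inf_leP; exists n => //.
have [L' LL'] := nth_syzygy_exists n L R_bd.
have [X1 XX1] := syzygy_exists X R_bd; have [Y1 YY1] := syzygy_exists Y R_bd.
(* [N] and [n] are kept: stably [L'] is a summand of [X1], and [X1] of [Y1], the next syzygy of
   [N]. *)
exists N, L', Y1; split=> //; first by rewrite addnS; exists Y.
apply: summand_upto_projective_trans (summand_syzygy XX1 YY1 XY).
exact: (summand_syzygy_kernel Q_proj f_surj l_inj lE CX XX1 LL').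
Qed.

Lemma dell_pred (R : pzRingType) (j m : nat) (C : fgmod R) :
  enat_le_nat (dell j.+1 C) m -> enat_le_nat (dell j C) m.
Proof.
move=> /enat_inf_leP[n nm [N [X [Y [CX NY XY]]]]].
apply/enat_inf_leP; exists n => //.
by rewrite addnS in NY; have [N' N'Y] := nth_syzygy_shift NY; exists N', X, Y.
Qed.

(** * Chains of modules over a finite dimensional algebra *)

(** [M] is the image under [psi] of the [K]-space of functions from ['I_n] to [A], whose dimension
    is the bound. A longer strict chain would lift to too many independent vectors there. *)
Lemma bounded_chains_converse (K : fieldType) (A : falgType K) :
  bounded_chains A^c.
Proof.
move=> M; have [n [g gE]] := fgmodP M.
pose psi (v : {ffun 'I_n -> A}) : M := \sum_i (v i : A^c) *: g i.
have psiP c u v : psi (c *: u + v) = (c%:A : A^c) *: psi u + psi v.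
  rewrite /psi scaler_sumr -big_split; apply: eq_bigr => i _ /=.
  rewrite !ffunE scalerA -scalerDl; congr (_ *: _); congr (_ + _).
  (* In the converse ring, multiplying by [c%:A] on the left is multiplying by it on the right in
     [A], which is scaling by [c]. *)
  by rewrite -[LHS](mulr1 (c *: u i)) -scalerAl scalerAr.
exists (\dim {: {ffun 'I_n -> A}}) => S S_sub S_mono; apply: contrapT => noS.
have step i : exists v, (i <= \dim {: {ffun 'I_n -> A}})%N ->
    S i.+1 (psi v) /\ ~ S i (psi v).
  apply: contrapT => /forallNP no_v.
  have i_le : (i <= \dim {: {ffun 'I_n -> A}})%N.
    by apply: contrapT => i_gt; apply: (no_v 0).
  apply: noS; exists i => // x Sx; apply: contrapT => nSx.
  have [c cE] := gE x; apply: (no_v [ffun i => c i]) => _.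
  suff -> : psi [ffun i => c i] = x by [].
  by rewrite cE; apply: eq_bigr => j _; rewrite ffunE.
have {step noS} [y yE] := choice step.
pose s j := [seq y i | i <- rev (iota 0 j)].
have sS j : s j.+1 = y j :: s j by rewrite /s -addn1 iotaD rev_cat.
(* The span of the first [j] vectors maps into [S j], while [psi (y j)] is outside [S j]; hence
   [y j] is independent of them. *)
have span_S j : (j <= (\dim {: {ffun 'I_n -> A}}).+1)%N ->
    free (s j) /\ forall v, v \in <<s j>>%VS -> S j (psi v).
  elim: j => [_|j IH j_lt].
    split=> [|v]; first exact: nil_free.
    rewrite span_nil memv0 => /eqP ->.
    suff -> : psi 0 = 0 by case: (S_sub 0%N).
    by rewrite /psi big1 // => i _; rewrite ffunE scale0r.
  have [s_free s_S] := IH (ltnW j_lt); have [Sy nSy] := yE _ j_lt.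
  rewrite sS free_cons s_free andbT; split.
    by apply/negP => /s_S.
  move=> v; rewrite span_cons => /memv_addP[_ /vlineP[c ->] [u su ->]].
  by rewrite psiP; apply: (S_sub j.+1).2 => //; apply/S_mono/s_S.
have [s_free _] := span_S _ (leqnn _).
have := dimvS (subvf <<s (\dim {: {ffun 'I_n -> A}}).+1>>%VS).
by rewrite (eqP s_free) size_map size_rev size_iota ltnn.
Qed.

(** * Resolving the syzygy of [M] *)

(** A projective cover is taken, rather than any epimorphism, so that [Q] vanishes with the kernel;
    this keeps the new resolution from getting longer. *)
Lemma kernel_cover (R : pzRingType) (C D : fgmod R) (g : {linear C -> D}) :
  bounded_chains R ->
  exists (Q : fgmod R) (a : {linear Q -> C}),
    [/\ projective Q, exact_at a g &
        (forall c, g c = 0 -> c = 0) -> forall x : Q, x = 0].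
Proof.
move=> R_bd.
have [W [w [w_inj wE]]] := submodule_fgmod R_bd (submodule_kernel g).
have [Q [f [Q_proj f_surj f_sup]]] := projective_cover_exists W R_bd.
exists Q, (w \o f); split=> // [c|g_inj x].
  split=> [/wE[z <-]|[x <-]]; last by apply/wE; exists (f x).
  by have [x <-] := f_surj z; exists x.
(* If the kernel is 0, then [f] is 0, and 0 plus its kernel is all of [Q]. *)
apply/eqP; apply: (f_sup (pred1 0)).
  split=> [|a u v]; rewrite !inE // => /eqP-> /eqP->.
  by rewrite scaler0 addr0.
move=> u; exists 0, u; split; rewrite ?inE ?add0r //; apply: w_inj.
by rewrite linear0; apply/g_inj/wE; exists (f u).
Qed.

(* For an exact [C] over [M], cover the [i]-th cycle module by [Q i] (so [Q 0]
   covers [M]) and lift to [q i : Q i -> C i]. The kernels of the resulting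
   [Q i.+1 * Q i -> C i] form an exact sequence over the syzygy of [M], with
   differential [(x, y) |-> (y, 0)]. *)
Lemma syzygy_resolution (R : pzRingType) (n : nat) (M OmegaM : fgmod R)
    (C : nat -> fgmod R) (e : {linear C 0%N -> M})
    (d : forall i, {linear C i.+1 -> C i}) :
  bounded_chains R -> is_syzygy M OmegaM -> exact_resolution n e d ->
  exists (L : nat -> fgmod R) (e' : {linear L 0%N -> OmegaM})
         (d' : forall i, {linear L i.+1 -> L i}),
    exact_resolution n e' d' /\
    forall i, exists (Q : fgmod R) (f : {linear Q -> C i})
                     (l : {linear L i -> Q}),
      [/\ projective Q, surj f, injective l & exact_at l f].
Proof.
move=> R_bd [P [p [j [[P_proj p_surj _] j_inj jE]]]] [C0 e_surj ed dd].
(* Shifted indexing treats the augmentation [e] as the differential out of [C 0]. *)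
pose T i : fgmod R := if i is i'.+1 then C i' else M.
pose g i : {linear C i -> T i} :=
  match i return {linear C i -> T i} with 0%N => e | i'.+1 => d i' end.
have gd i : exact_at (d i) (g i) by case: i.
pose Qc i := cid (kernel_cover (g i) R_bd).
pose ac i := cid (svalP (Qc i)).
pose Q i : fgmod R := if i is i'.+1 then sval (Qc i') else P.
pose a i : {linear Q i -> T i} :=
  match i return {linear Q i -> T i} with 0%N => p | i'.+1 => sval (ac i') end.
have Q_proj i : projective (Q i) by case: i => //= i; case: (svalP (ac i)).
have ag i : exact_at (a i.+1 : {linear Q i.+1 -> C i}) (g i).
  by case: (svalP (ac i)).
(* For positive [i], [Q i] covers the image of [C i], which is 0 beyond [n]. *)
have Q0 i : (n < i)%N -> forall x : Q i, x = 0.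
  case: i => // i ni; case: (svalP (ac i)) => _ _; apply=> c /gd[x <-].
  by rewrite (C0 _ ni x) linear0.
have im_ag i t : (exists c, g i c = t) <-> (exists y, a i y = t).
  case: i t => [|i] t; first by split=> _; [exact: p_surj | exact: e_surj].
  by split=> [/gd/ag|/ag/gd].
have lift i : exists q : {linear Q i -> C i}, forall y, g i (q y) = a i y.
  by apply: projective_lift => // y; apply/im_ag; exists y.
pose q i := sval (cid (lift i)).
have qE i y : g i (q i y) = a i y by exact: (svalP (cid (lift i))).
pose a' i : {linear Q i.+1 -> C i} := a i.+1.
have phi_lin i : linear (fun z : (Q i.+1 * Q i)%type => a' i z.1 + q i z.2).
  by move=> b x y; rewrite /= !linearP addrACA scalerDr.
pose phi i : {linear fgmod_prod (Q i.+1) (Q i) -> C i} := mk_linear (phi_lin i).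
have phiE i x y : phi i (x, y) = a' i x + q i y by [].
have phi_surj i : surj (phi i).
  (* Match [c] modulo the kernel of [g i] using [q i y]; the difference is a cycle, so it comes from
     [Q i.+1]. *)
  move=> c; have [y yE] : exists y, a i y = g i c by apply/im_ag; exists c.
  have [x xE] : exists x, a' i x = c - q i y.
    by apply/ag; rewrite linearB qE yE subrr.
  by exists (x, y); rewrite phiE xE subrK.
pose Lc i := cid (submodule_fgmod R_bd (submodule_kernel (phi i))).
pose L i := sval (Lc i).
pose lc i := cid (svalP (Lc i)).
pose l i : {linear L i -> fgmod_prod (Q i.+1) (Q i)} := sval (lc i).
have l_inj i : injective (l i) by case: (svalP (lc i)).
have lE i : exact_at (l i) (phi i) by case: (svalP (lc i)).
have snd_lin i : linear (fun z : (Q i.+1 * Q i)%type => z.2) by [].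
have inl_lin i : linear (fun x : Q i.+1 => (x, 0) : (Q i.+1 * Q i)%type).
  by move=> b x y; congr pair => //=; rewrite scaler0 addr0.
(* With [ker_snd]: the second components of [L i] fill exactly the kernel of [a i], which for
   [i = 0] is the syzygy of [M]. *)
have a_snd i z : a i (l i z).2 = 0.
  have : phi i (l i z) = 0 by apply/lE; exists z.
  case: (l i z) => x y; rewrite phiE => /(congr1 (g i)).
  rewrite linearD qE linear0 => <-.
  by rewrite (_ : g i (a' i x) = 0) ?add0r //; apply/ag; exists x.
have ker_snd i y : a i y = 0 -> exists z, (l i z).2 = y.
  move=> ay; have [x xE] : exists x, a' i x = - q i y.
    by apply/ag; rewrite linearN qE ay oppr0.
  have /lE[z zE] : phi i (x, y) = 0 by rewrite phiE xE addNr.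
  by exists z; rewrite zE.
have diff i : exists d' : {linear L i.+1 -> L i},
    forall z, l i (d' z) = ((l i.+1 z).2, 0).
  apply: (linear_factor (f := mk_linear (inl_lin i) \o
    (mk_linear (snd_lin i.+1) \o l i.+1)) (l_inj i)) => z.
  have /lE//: phi i ((l i.+1 z).2, 0) = 0.
  by rewrite phiE (a_snd i.+1) linear0 addr0.
pose d' i := sval (cid (diff i)).
have d'E i z : l i (d' i z) = ((l i.+1 z).2, 0).
  exact: (svalP (cid (diff i))).
have [e' e'E] : exists e' : {linear L 0%N -> OmegaM},
    forall z, j (e' z) = (l 0%N z).2.
  apply: (linear_factor (f := mk_linear (snd_lin 0%N) \o l 0%N)) => // z.
  by apply/jE; exact: (a_snd 0%N).
(* Cycles and boundaries both amount to a zero second component, which gives exactness at every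
   [L i]. *)
have im_d' i z : (l i z).2 = 0 <-> exists t, d' i t = z.
  split=> [z2|[t <-]]; last by rewrite d'E.
  have [|t tE] := ker_snd i.+1 (l i z).1.
    have : phi i (l i z) = 0 by apply/lE; exists z.
    by rewrite [l i z]surjective_pairing phiE z2 linear0 addr0.
  by exists t; apply: l_inj; rewrite d'E tE -z2 -surjective_pairing.
exists L, e', d'; split; last first.
  by move=> i; exists (fgmod_prod (Q i.+1) (Q i)), (phi i), (l i); split=> //;
     exact: projective_prod.
split.
- move=> i ni z; apply: l_inj; rewrite linear0; case: (l i z) => x y.
  by rewrite (Q0 _ ni y) (Q0 _ (leqW ni) x).
- move=> y; have [|z zE] := ker_snd 0%N (j y); first by apply/jE; exists y.
  by exists z; apply: j_inj; rewrite e'E.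
- move=> z; rewrite -im_d' -e'E; split=> [->|/eqP]; first exact: linear0.
  by rewrite -(linear0 j) => /eqP/j_inj.
- move=> i z; rewrite -im_d'; split=> [dz|z2].
    by have := d'E i z; rewrite dz linear0 => -[].
  by apply: l_inj; rewrite d'E z2 linear0.
Qed.

Theorem lemma3p2 (K : fieldType) (A : falgType K) (k : nat) (hk : (1 <= k)%N)
    (M OmegaM : rmod A) (hOmega : is_syzygy M OmegaM)
    (hM : enat_lt_infty (ddell k M)) :
  enat_lt_infty (ddell (k + 1)%N OmegaM) /\ enat_lt_infty (ddell k OmegaM).
Proof.
have R_bd := @bounded_chains_converse K A.
have /enat_infP[m [n nm [C [e [d [Cd C_dell]]]]]] := hM.
have [L [e' [d' [Ld L_ker]]]] := syzygy_resolution R_bd hOmega Cd.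
have L_dell i : (i <= n)%N -> enat_le_nat (dell (i + k).+1 (L i)) (m - i)%N.
  move=> ni; have [Q [f [l [Q_proj f_surj l_inj lE]]]] := L_ker i.
  exact: (dell_kernel R_bd Q_proj f_surj l_inj lE (C_dell i ni)).
(* The same [m] and [n] serve for both claims: covering raises the index of [dell] by one and leaves
   its bound [m - i] unchanged. *)
split; apply/enat_infP; exists m, n => //; exists L, e', d'; split=> // i ni.
  by rewrite addn1 addnS; exact: L_dell.
by apply: dell_pred; exact: L_dell.
Qed.
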